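(* Let $\phi$ and $\psi$ be two $\mathbf{FO}^2$ sentences (function-free first-order sentences using at most two logical variables), equipped with real-valued weightings $(w,\overline{w})$ and $(w',\overline{w}')$ respectively, and let $G_{\phi}$ and $G_{\psi}$ be their respective cell graphs (computed with these weightings). If $G_{\phi}$ is isomorphic to $G_{\psi}$, then $$\mathsf{WFOMC}(\phi,n,w,\overline{w})=\mathsf{WFOMC}(\psi,n,w',\overline{w}')$$ for every domain size $n\in\mathbb{N}$.
   Context: Semantics: Herbrand semantics over a finite domain $\Delta$ of size $n$; $\mathsf{HB}$ is the set of all ground atoms; a possible world $\omega$ is a subset of $\mathsf{HB}$ (its elements true, all others false). A weighting is a pair of maps $w,\overline{w}:\mathcal{P}\to\mathbb{R}$ from the predicates of the language (positive and negative weight). Weighted first-order model counting: $\mathsf{WFOMC}(\phi,n,w,\overline{w})=\sum_{\omega\subseteq \mathsf{HB},\ \omega\models\phi}\prod_{l\in\omega}w(\mathrm{pred}(l))\prod_{l\in\mathsf{HB}\setminus\omega}\overline{w}(\mathrm{pred}(l))$, where $\mathrm{pred}(l)$ is the predicate of atom $l$. $\mathsf{WMC}$ denotes the analogous weighted model count of a ground (propositional) formula, summing over truth assignments to its ground atoms. Cell graphs are defined for a universally quantified sentence $\forall x\forall y\,\phi(x,y)$ with $\phi(x,y)$ quantifier-free; an $\mathbf{FO}^2$ sentence with existential quantifiers is first brought to this form by the standard WFOMC-preserving Skolemization, which introduces fresh Skolem predicates $Sk$ with $w(Sk)=1$, $\overline{w}(Sk)=-1$, and its cell graph is that of the resulting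 universal sentence. A cell of $\phi$ is a maximal consistent conjunction of literals formed from the atoms of $\phi$ using only a single variable (i.e. from the unary atoms $P(x)$ and reflexive atoms $R(x,x)$); let $C_1,\dots,C_p$ be the cells. Put $\psi_{ij}(x,y)=\phi(x,y)\wedge\phi(y,x)\wedge C_i(x)\wedge C_j(y)$ and $\psi_k(x)=\phi(x,x)\wedge C_k(x)$, and for distinct domain elements $A,B$ define $r_{ij}=\mathsf{WMC}(\psi_{ij}(A,B),w_*,\overline{w}_* )$ and $w_k=\mathsf{WMC}(\psi_k(A),w,\overline{w})$, where $(w_*,\overline{w}_* )$ agrees with $(w,\overline{w})$ except that all atoms occurring in the conditioned cells (the unary and reflexive atoms on $A$ and $B$) get weight $1$ (both positive and negative). The cell graph $G_\phi$ is the complete graph on vertex set $\{1,\dots,p\}$ (with loops) in which vertex $i$ is labelled $w_i$ and the edge $\{i,j\}$ (including loops $i=j$) is labelled $r_{ij}$ (note $r_{ij}=r_{ji}$). Two cell graphs $G,G'$ with vertex labels $w_i$, $w'_i$ and edge labels $r_{ij}$, $r'_{ij}$ are isomorphic if there is a bijection $f:V(G)\to V(G')$ such that $w'_i=w_{f(i)}$ and $r'_{ij}=r_{f(i),f(j)}$ for all $i,j$.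
   Formalization: Predicates are unary or binary only; the cells and edge and vertex labels count all ground atoms of the vocabulary on A, B (even those not written in the sentence); at n = 0 every sentence counts as true. Without these changes the claim fails. *)

(* Defs.v *)
From HB Require Import structures.
From mathcomp Require Import all_boot all_order all_algebra reals.

Set Implicit Arguments.
Unset Strict Implicit.
Unset Printing Implicit Defensive.

Import GRing.Theory.
Local Open Scope ring_scope.

(** * Syntax of FO^2 *)

(* Relational vocabularies with unary and binary predicates: these are the
   arities for which every ground atom mentions one or two domain elements,
   so that it is seen by some vertex label or edge label of a cell graph. *)
Record signature := Signature { unary : finType; binary : finType }.

Definition pred_sym (S : signature) : finType := (unary S + binary S)%type.

(* Atoms over a type of terms: terms are variables in first-order formulas
   and domain elements in ground formulas. *)
Definition atom (S : signature) (T : Type) : Type :=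
  (unary S * T + binary S * (T * T))%type.

HB.instance Definition _ (S : signature) (T : finType) :=
  Finite.copy (atom S T) (unary S * T + binary S * (T * T))%type.

Definition map_atom (S : signature) (T T' : Type) (f : T -> T')
    (a : atom S T) : atom S T' :=
  match a with
  | inl (p, t) => inl (p, f t)
  | inr (r, (t, t')) => inr (r, (f t, f t'))
  end.

Definition pred_of (S : signature) (T : Type) (a : atom S T) : pred_sym S :=
  match a with inl (p, _) => inl p | inr (r, _) => inr r end.

(* P(t) for unary P, R(t, t) for binary R *)
Definition diag_atom (S : signature) (T : Type) (p : pred_sym S) (t : T) :
    atom S T :=
  match p with inl u => inl (u, t) | inr r => inr (r, (t, t)) end.

Notation var := bool.
Notation vx := false.
Notation vy := true.
Definition other (v : var) : var := ~~ v.

Inductive fo2 (S : signature) : Type :=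
| FTop
| FBot
| FAtom of atom S var
| FNot of fo2 S
| FAnd of fo2 S & fo2 S
| FOr of fo2 S & fo2 S
| FImp of fo2 S & fo2 S
| FIff of fo2 S & fo2 S
| FAll of var & fo2 S
| FEx of var & fo2 S.

Arguments FTop {S}.
Arguments FBot {S}.

Definition occurs (S : signature) (v : var) (a : atom S var) : bool :=
  match a with
  | inl (_, t) => t == v
  | inr (_, (t, t')) => (t == v) || (t' == v)
  end.

Fixpoint free (S : signature) (v : var) (f : fo2 S) : bool :=
  match f with
  | FTop | FBot => false
  | FAtom a => occurs v a
  | FNot g => free v g
  | FAnd g h | FOr g h | FImp g h | FIff g h => free v g || free v h
  | FAll u g | FEx u g => (v != u) && free v g
  end.

Definition sentence (S : signature) (f : fo2 S) : bool :=
  [forall v : var, ~~ free v f].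

(* Quantifier-free formulas over terms in T *)
Inductive qform (S : signature) (T : Type) : Type :=
| QTop
| QBot
| QAtom of atom S T
| QNot of qform S T
| QAnd of qform S T & qform S T
| QOr of qform S T & qform S T
| QImp of qform S T & qform S T
| QIff of qform S T & qform S T.

Arguments QTop {S T}.
Arguments QBot {S T}.

Fixpoint subst (S : signature) (T T' : Type) (f : T -> T') (q : qform S T) :
    qform S T' :=
  match q with
  | QTop => QTop
  | QBot => QBot
  | QAtom a => QAtom (map_atom f a)
  | QNot g => QNot (subst f g)
  | QAnd g h => QAnd (subst f g) (subst f h)
  | QOr g h => QOr (subst f g) (subst f h)
  | QImp g h => QImp (subst f g) (subst f h)
  | QIff g h => QIff (subst f g) (subst f h)
  end.

(** * Herbrand semantics and weighted model counting *)

(* [atom S D] is the Herbrand base over the domain D. *)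
Notation world S D := {set atom S D}.

Definition upd (D : Type) (env : var -> D) (v : var) (d : D) : var -> D :=
  fun u => if u == v then d else env u.

Fixpoint sat (S : signature) (D : finType) (omega : world S D)
    (env : var -> D) (f : fo2 S) : bool :=
  match f with
  | FTop => true
  | FBot => false
  | FAtom a => map_atom env a \in omega
  | FNot g => ~~ sat omega env g
  | FAnd g h => sat omega env g && sat omega env h
  | FOr g h => sat omega env g || sat omega env h
  | FImp g h => sat omega env g ==> sat omega env h
  | FIff g h => sat omega env g == sat omega env h
  | FAll v g => [forall d : D, sat omega (upd env v d) g]
  | FEx v g => [exists d : D, sat omega (upd env v d) g]
  end.

(* Truth under every assignment; for a sentence over a nonempty domain the
   assignment is irrelevant.  First-order structures are nonempty: over the
   empty domain there is no assignment and every sentence counts as true. *)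
Definition models (S : signature) (D : finType) (omega : world S D)
    (f : fo2 S) : bool :=
  [forall env : {ffun var -> D}, sat omega env f].

Fixpoint qsat (S : signature) (D : finType) (omega : world S D)
    (q : qform S D) : bool :=
  match q with
  | QTop => true
  | QBot => false
  | QAtom a => a \in omega
  | QNot g => ~~ qsat omega g
  | QAnd g h => qsat omega g && qsat omega h
  | QOr g h => qsat omega g || qsat omega h
  | QImp g h => qsat omega g ==> qsat omega h
  | QIff g h => qsat omega g == qsat omega h
  end.

Definition WFOMC (R : realType) (S : signature) (f : fo2 S) (n : nat)
    (w wbar : pred_sym S -> R) : R :=
  \sum_(omega : world S 'I_n | models omega f)
    (\prod_(l in omega) w (pred_of l)) *
    (\prod_(l in ~: omega) wbar (pred_of l)).

(* The weights are per ground atom, since the edge labels of a cell graph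
   weigh R(A, A) and R(A, B) differently.  The sum ranges over the truth
   assignments to all ground atoms of the vocabulary over D. *)
Definition WMC (R : realType) (S : signature) (D : finType) (q : qform S D)
    (u ubar : atom S D -> R) : R :=
  \sum_(omega : world S D | qsat omega q)
    (\prod_(l in omega) u l) * (\prod_(l in ~: omega) ubar l).

(** * Cell graphs *)

Record cell_graph (R : realType) := CellGraph {
  vertex : finType;
  vlabel : vertex -> R;
  elabel : vertex -> vertex -> R
}.

Definition isomorphic (R : realType) (G G' : cell_graph R) : Prop :=
  exists f : vertex G -> vertex G',
    [/\ bijective f,
        forall i, vlabel (f i) = vlabel i
      & forall i j, elabel (f i) (f j) = elabel i j].

(* A cell, given by the sign of each of its literals *)
Definition cell (S : signature) : finType := {ffun pred_sym S -> bool}.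

Definition cell_formula (S : signature) (T : Type) (c : cell S) (t : T) :
    qform S T :=
  \big[@QAnd S T/QTop]_(p : pred_sym S)
    (if c p then QAtom (diag_atom p t) else QNot (QAtom (diag_atom p t))).

Definition psi2 (S : signature) (phi : qform S var) (ci cj : cell S) :
    qform S var :=
  QAnd phi (QAnd (subst other phi)
    (QAnd (cell_formula ci vx) (cell_formula cj vy))).

Definition psi1 (S : signature) (phi : qform S var) (c : cell S) :
    qform S var :=
  QAnd (subst (fun=> vx) phi) (cell_formula c vx).

Definition unit_on_cells (R : realType) (S : signature) (D : finType)
    (w : pred_sym S -> R) (a : atom S D) : R :=
  match a with
  | inl _ => 1
  | inr (r, (d, d')) => if d == d' then 1 else w (inr r)
  end.

(* The domain {A, B} is 'I_2 for edge labels; {A} is 'I_1 for vertex labels. *)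
Definition edge_weight (R : realType) (S : signature) (phi : qform S var)
    (w wbar : pred_sym S -> R) (ci cj : cell S) : R :=
  WMC (subst (fun v => if v == vx then ord0 else ord_max : 'I_2)
         (psi2 phi ci cj))
      (unit_on_cells w) (unit_on_cells wbar).

Definition vertex_weight (R : realType) (S : signature) (phi : qform S var)
    (w wbar : pred_sym S -> R) (c : cell S) : R :=
  WMC (subst (fun=> ord0 : 'I_1) (psi1 phi c))
      (fun a => w (pred_of a)) (fun a => wbar (pred_of a)).

(* Cell graph of the universal sentence forall x y, phi(x, y) *)
Definition cell_graph_univ (R : realType) (S : signature)
    (phi : qform S var) (w wbar : pred_sym S -> R) : cell_graph R :=
  CellGraph (vertex_weight phi w wbar) (edge_weight phi w wbar).

(** * Skolemization

   Van den Broeck, Meert and Darwiche (KR 2014), on top of Scott normal form.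
   - A quantified subformula [Q v, g], with free variable v' other than v at
     most, is replaced by Z(v') for a fresh definition predicate Z, with both
     weights 1, and [forall v', Z(v') <-> Q v, g] is added; this is the
     conjunction of a forall-forall and a forall-exists sentence.
   - A sentence [forall v', exists v, g] with g quantifier-free becomes
     [forall v' v, Sk(v') \/ ~ g] for a fresh Skolem predicate Sk, with
     weights 1 and -1.
   Definitions are only introduced below the outermost conjunctions and
   universal quantifiers, and not for an existential quantifier reached
   through these alone.  In particular forall x y, g with g quantifier-free
   keeps its matrix, and forall x, exists y, g yields Sk(x) \/ ~ g. *)

(* Occurrences of quantifiers *)
Fixpoint qocc (S : signature) (f : fo2 S) : finType :=
  match f with
  | FTop | FBot | FAtom _ => void
  | FNot g => qocc g
  | FAnd g h | FOr g h | FImp g h | FIff g h => (qocc g + qocc h)%type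
  | FAll _ g | FEx _ g => option (qocc g)
  end.

(* Index of the definition predicates *)
Fixpoint docc (S : signature) (f : fo2 S) : finType :=
  match f with
  | FAnd g h => (docc g + docc h)%type
  | FAll _ g => docc g
  | FEx _ g => qocc g
  | _ => qocc f
  end.

(* Index of the Skolem predicates *)
Fixpoint socc (S : signature) (f : fo2 S) : finType :=
  match f with
  | FAnd g h => (socc g + socc h)%type
  | FAll _ g => socc g
  | FEx _ g => option (qocc g)
  | _ => qocc f
  end.

Section Matrix.
Variables (S : signature) (U : finType) (old : unary S -> U).

Let S' : signature := Signature U (binary S).

Definition lift_atom (a : atom S var) : atom S' var :=
  match a with inl (p, t) => inl (old p, t) | inr rt => inr rt end.

Definition uatom (u : U) (v : var) : qform S' var :=
  QAtom (inl (u, v) : atom S' var).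

(* Outermost quantified subformulas replaced by their definition predicates *)
Fixpoint flatten (f : fo2 S) : (qocc f -> U) -> qform S' var :=
  match f return (qocc f -> U) -> qform S' var with
  | FTop => fun _ => QTop
  | FBot => fun _ => QBot
  | FAtom a => fun _ => QAtom (lift_atom a)
  | FNot g => fun d => QNot (@flatten g d)
  | FAnd g h => fun d => QAnd (@flatten g (d \o inl)) (@flatten h (d \o inr))
  | FOr g h => fun d => QOr (@flatten g (d \o inl)) (@flatten h (d \o inr))
  | FImp g h => fun d => QImp (@flatten g (d \o inl)) (@flatten h (d \o inr))
  | FIff g h => fun d => QIff (@flatten g (d \o inl)) (@flatten h (d \o inr))
  | FAll v _ | FEx v _ => fun d => uatom (d None) (other v)
  end.

(* Skolemized definitions of all the definition predicates:
   Z <-> exists v, g  is  (g -> Z) and exists v, (Z -> g);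
   Z <-> forall v, g  is  (Z -> g) and exists v, (g -> Z). *)
Fixpoint definitions (f : fo2 S) :
    (qocc f -> U) -> (qocc f -> U) -> qform S' var :=
  match f return (qocc f -> U) -> (qocc f -> U) -> qform S' var with
  | FTop | FBot | FAtom _ => fun _ _ => QTop
  | FNot g => fun d s => @definitions g d s
  | FAnd g h | FOr g h | FImp g h | FIff g h => fun d s =>
      QAnd (@definitions g (d \o inl) (s \o inl))
           (@definitions h (d \o inr) (s \o inr))
  | FAll v g => fun d s =>
      let z := uatom (d None) (other v) in
      let sk := uatom (s None) (other v) in
      let g' := @flatten g (d \o Some) in
      QAnd (QImp z g')
        (QAnd (QOr sk (QNot (QImp g' z)))
              (@definitions g (d \o Some) (s \o Some)))
  | FEx v g => fun d s =>
      let z := uatom (d None) (other v) in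
      let sk := uatom (s None) (other v) in
      let g' := @flatten g (d \o Some) in
      QAnd (QImp g' z)
        (QAnd (QOr sk (QNot (QImp z g')))
              (@definitions g (d \o Some) (s \o Some)))
  end.

(* Uses that f and forall v, f have the same universal closure, and that the
   universal closure of exists v, g is forall v', exists v, g. *)
Fixpoint matrix (f : fo2 S) :
    (docc f -> U) -> (socc f -> U) -> qform S' var :=
  match f return (docc f -> U) -> (socc f -> U) -> qform S' var with
  | FAnd g h => fun d s =>
      QAnd (@matrix g (d \o inl) (s \o inl)) (@matrix h (d \o inr) (s \o inr))
  | FAll _ g => fun d s => @matrix g d s
  | FEx v g => fun d s =>
      QAnd (QOr (uatom (s None) (other v)) (QNot (@flatten g d)))
           (@definitions g d (s \o Some))
  | f0 => fun d s => QAnd (@flatten f0 d) (@definitions f0 d s)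
  end.

End Matrix.

Definition skolem_sig (S : signature) (f : fo2 S) : signature :=
  Signature (unary S + (docc f + socc f))%type (binary S).

Definition skolem_matrix (S : signature) (f : fo2 S) :
    qform (skolem_sig f) var :=
  @matrix S (unary S + (docc f + socc f))%type inl f
    (fun o => inr (inl o)) (fun o => inr (inr o)).

(* [sk] is the weight given to the Skolem predicates *)
Definition skolem_weight (R : realType) (S : signature) (f : fo2 S) (sk : R)
    (w : pred_sym S -> R) (p : pred_sym (skolem_sig f)) : R :=
  match p with
  | inl (inl u) => w (inl u)
  | inl (inr (inl _)) => 1
  | inl (inr (inr _)) => sk
  | inr r => w (inr r)
  end.

Definition cell_graph_of (R : realType) (S : signature) (f : fo2 S)
    (w wbar : pred_sym S -> R) : cell_graph R :=
  cell_graph_univ (skolem_matrix f)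
    (skolem_weight 1 w) (skolem_weight (-1) wbar).

(* Main.v *)
Require Import Defs.
From mathcomp Require Import all_boot all_order all_algebra reals.

Set Implicit Arguments.
Unset Strict Implicit.
Unset Printing Implicit Defensive.

Import GRing.Theory.
Local Open Scope ring_scope.

(* A world over 'I_n is a choice of a cell for each element together with, for
   each pair i < j, the truth values of the binary atoms between i and j.  A
   universal sentence constrains the elements and the pairs independently, so
   distributivity turns the count into the sum, over all maps c from 'I_n to the
   cells, of the product of the vertex labels of the c i and of the edge labels
   of the (c i, c j); this sum is visibly invariant under isomorphism.

   Skolemization preserves the count: for fixed definition predicates, the
   signed sum over the Skolem predicates is the indicator that all guards hold,
   and then the definition predicates are forced to be the truth values of the
   subformulas they stand for. *)

(** * Boolean valuations of quantifier-free formulas, and weights as single products *)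

Fixpoint qeval (S : signature) (T : Type) (I : atom S T -> bool)
    (q : qform S T) : bool :=
  match q with
  | QTop => true
  | QBot => false
  | QAtom a => I a
  | QNot g => ~~ qeval I g
  | QAnd g h => qeval I g && qeval I h
  | QOr g h => qeval I g || qeval I h
  | QImp g h => qeval I g ==> qeval I h
  | QIff g h => qeval I g == qeval I h
  end.

Lemma eq_qeval (S : signature) (T : Type) (I J : atom S T -> bool) q :
  I =1 J -> qeval I q = qeval J q.
Proof.
move=> eIJ; elim: q => //= [g ->|g -> h ->|g -> h ->|g -> h ->|g -> h ->] //.
Qed.

Lemma qeval_subst (S : signature) (T T' : Type) (f : T -> T')
    (I : atom S T' -> bool) q :
  qeval I (subst f q) = qeval (I \o map_atom f) q.
Proof.
by elim: q => //= [g ->|g -> h ->|g -> h ->|g -> h ->|g -> h ->].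
Qed.

Lemma qsat_qeval (S : signature) (D : finType) (omega : world S D) q :
  qsat omega q = qeval (fun a => a \in omega) q.
Proof.
by elim: q => //= [g ->|g -> h ->|g -> h ->|g -> h ->|g -> h ->].
Qed.

Lemma qsat_subst (S : signature) (T : Type) (D : finType) (omega : world S D)
    (f : T -> D) q :
  qsat omega (subst f q) = qeval (fun a => map_atom f a \in omega) q.
Proof. by rewrite qsat_qeval qeval_subst. Qed.

Lemma qeval_cell_formula (S : signature) (T : Type) (I : atom S T -> bool)
    (c : cell S) t :
  qeval I (cell_formula c t) = [forall p, I (diag_atom p t) == c p].
Proof.
rewrite /cell_formula (big_morph (qeval I) (id1 := true) (op1 := andb)) //.
rewrite big_andE; apply: eq_forallb => p.
by case: (c p) => /=; case: (I _).
Qed.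

Lemma map_atom_comp (S : signature) (T T' T'' : Type) (g : T' -> T'')
    (f : T -> T') (a : atom S T) :
  map_atom g (map_atom f a) = map_atom (g \o f) a.
Proof. by case: a => [[u t]|[r [t t']]]. Qed.

Lemma eq_map_atom (S : signature) (T T' : Type) (f g : T -> T')
    (a : atom S T) :
  f =1 g -> map_atom f a = map_atom g a.
Proof. by move=> e; case: a => [[u t]|[r [t t']]] /=; rewrite !e. Qed.

(** With one product over the whole Herbrand base, distributivity can act atom by atom. *)
Lemma prod_in_world (R : realType) (A : finType) (omega : {set A})
    (u v : A -> R) :
  (\prod_(l in omega) u l) * (\prod_(l in ~: omega) v l) =
  \prod_l (if l \in omega then u l else v l).
Proof.
rewrite [RHS](bigID (mem omega)) /=; congr (_ * _).
  by apply: eq_bigr => l ->.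
by apply: eq_big => l; rewrite inE // => /negbTE ->.
Qed.

Lemma prod_boolr (R : realType) (A : finType) (P : pred A) :
  \prod_a (P a)%:R = [forall a, P a]%:R :> R.
Proof.
have -> : [forall a, P a] = \big[andb/true]_a P a by rewrite big_andE.
by elim/big_rec2: _ => // a x b _ ->; rewrite -natrM mulnb.
Qed.

Definition univ_models (S : signature) (D : finType) (omega : world S D)
    (q : qform S var) : bool :=
  [forall env : {ffun var -> D}, qsat omega (subst env q)].

(** The model count of a universal sentence with matrix [q]: Skolemization arrives at it, and the
    cell decomposition starts from it. *)
Definition univ_count (R : realType) (S : signature) (q : qform S var)
    (n : nat) (w wbar : pred_sym S -> R) : R :=
  \sum_(omega : world S 'I_n | univ_models omega q)
    \prod_l (if l \in omega then w (pred_of l) else wbar (pred_of l)).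

(** * Decomposition of worlds into cells and pairs *)

Section Cells.
Variable S : signature.

Section World.
Variable n : nat.

(** Each unordered pair of distinct elements is represented once, by its increasing ordering. *)
Definition opair : finType := {p : 'I_n * 'I_n | (p.1 < p.2)%N}.

Definition pair_type : finType := {ffun binary S * bool -> bool}.

(** A ground atom either is read off the cell of a single element or lies between two distinct
    elements; the Herbrand base thus becomes a disjoint sum over elements and pairs. *)
Definition atom_code : finType :=
  (pred_sym S * 'I_n + opair * (binary S * bool))%type.

(* the boolean component tells whether the pair is read backwards *)
Definition decode_atom (x : atom_code) : atom S 'I_n :=
  match x with
  | inl (p, d) => diag_atom p d
  | inr (p, (r, b)) =>
      inr (r, if b then ((val p).2, (val p).1) else val p)
  end.

Definition code_atom (a : atom S 'I_n) : atom_code :=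
  match a with
  | inl (u, d) => inl (inl u, d)
  | inr (r, (i, j)) =>
      match (insub (i, j) : option opair), (insub (j, i) : option opair) with
      | Some p, _ => inr (p, (r, false))
      | None, Some p => inr (p, (r, true))
      | None, None => inl (inr r, i)
      end
  end.

Lemma decode_atomK : cancel decode_atom code_atom.
Proof.
case=> [[[u|r] d]|[[[i j] /= ltij] [r []]]] /=.
- by [].
- by rewrite !insubF //= ltnn.
- have nji : ((j, i).1 < (j, i).2)%N = false by rewrite /= ltnNge ltnW.
  rewrite (@insubF _ (fun p : 'I_n * 'I_n => (p.1 < p.2)%N) _ _ nji).
  by rewrite (@insubT _ (fun p : 'I_n * 'I_n => (p.1 < p.2)%N) _ (i, j) ltij).
- by rewrite (@insubT _ (fun p : 'I_n * 'I_n => (p.1 < p.2)%N) _ (i, j) ltij).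
Qed.

Lemma code_atomK : cancel code_atom decode_atom.
Proof.
case=> [[u d]|[r [i j]]] //=.
case: insubP => [p _ /= <- //|/= leji].
case: insubP => [p _ /= -> //|/= leij].
(* Neither order of [i] and [j] is increasing, so the two elements coincide and the atom is
   reflexive. *)
congr (inr (_, (_, _))); apply/val_inj/eqP => /=.
by rewrite eqn_leq leqNgt leij leqNgt leji.
Qed.

Definition mk_world (x : {ffun 'I_n -> cell S} * {ffun opair -> pair_type}) :
    world S 'I_n :=
  [set a | match code_atom a with
           | inl (p, d) => x.1 d p
           | inr (p, rb) => x.2 p rb
           end].

Lemma mk_world_decode x y :
  (decode_atom y \in mk_world x) =
  match y with inl (p, d) => x.1 d p | inr (p, rb) => x.2 p rb end.
Proof. by rewrite inE decode_atomK. Qed.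

Lemma mk_world_bij : bijective mk_world.
Proof.
exists (fun omega : world S 'I_n =>
  ([ffun d => [ffun p => decode_atom (inl (p, d)) \in omega]],
   [ffun p => [ffun rb => decode_atom (inr (p, rb)) \in omega]])).
  move=> [c t]; congr (_, _); apply/ffunP => i; apply/ffunP => j;
    by rewrite !ffunE mk_world_decode.
move=> omega; apply/setP => a; rewrite -[a]code_atomK mk_world_decode.
by case: (code_atom a) => [[p d]|[p rb]]; rewrite !ffunE.
Qed.

Definition pair_weight (R : realType) (u v : atom S 'I_n -> R) (p : opair)
    (t : pair_type) : R :=
  \prod_rb (if t rb then u (decode_atom (inr (p, rb)))
            else v (decode_atom (inr (p, rb)))).

Definition diag_weight (R : realType) (u v : atom S 'I_n -> R) (d : 'I_n)
    (c : cell S) : R :=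
  \prod_p (if c p then u (diag_atom p d) else v (diag_atom p d)).

(** Once the cells are fixed, the condition on a world is a conjunction over pairs and its weight a
    product over atom codes, so the sum over pair types factors. The lemma serves for domains of
    size 1 (vertex labels), 2 (edge labels) and [n]. *)
Lemma sum_worlds_cells (R : realType) (u v : atom S 'I_n -> R)
    (Q : pred (world S 'I_n)) (A : pred {ffun 'I_n -> cell S})
    (B : {ffun 'I_n -> cell S} -> opair -> pred pair_type) :
  (forall c t, Q (mk_world (c, t)) = A c && [forall p, B c p (t p)]) ->
  \sum_(omega | Q omega) \prod_l (if l \in omega then u l else v l) =
  \sum_(c | A c) (\prod_d diag_weight u v d (c d)) *
                 \prod_p \sum_(t | B c p t) pair_weight u v p t.
Proof.
move=> QAB; rewrite (reindex mk_world); last exact: onW_bij mk_world_bij.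
(* Distributivity: a product over pairs of sums over types is a sum over all assignments of types to
   pairs. *)
under [RHS]eq_bigr => c _ do rewrite bigA_distr_big_dep mulr_sumr.
rewrite pair_big_dep; apply: eq_big => [[c t]|[c t] _] /=.
  by rewrite QAB.
rewrite (reindex decode_atom) /=; last first.
  by apply: onW_bij; exists code_atom; [exact: decode_atomK|exact: code_atomK].
under eq_bigr => y _ do rewrite mk_world_decode.
rewrite big_sumType /=; congr (_ * _).
  rewrite /diag_weight exchange_big pair_bigA /=.
  by apply: eq_bigr => [[p d]].
by rewrite /pair_weight pair_bigA /=; apply: eq_bigr => [[p rb]].
Qed.

End World.

(** * Truth of a universal sentence in terms of cells and pair types *)

Definition cell_val (c : cell S) (a : atom S var) : bool := c (pred_of a).

(** For an atom on two different variables the first one determines the order, so [v] itself serves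
    as the flag for reading the pair backwards. *)
Definition pair_val (ci cj : cell S) (t : pair_type) (a : atom S var) : bool :=
  match a with
  | inl (u, v) => (if v then cj else ci) (inl u)
  | inr (r, (v, v')) =>
      if v == v' then (if v then cj else ci) (inr r) else t (r, v)
  end.

Definition cell_ok (q : qform S var) (c : cell S) : bool :=
  qeval (cell_val c) q.

(** Both orders of the pair are tested, as in [psi2], because a pair is represented only once. *)
Definition pair_ok (q : qform S var) (ci cj : cell S) (t : pair_type) : bool :=
  qeval (pair_val ci cj t) q && qeval (pair_val ci cj t) (subst other q).

Definition pair_env (D : Type) (i j : D) (v : var) : D := if v then j else i.

Section Truth.
Variables (n : nat) (c : {ffun 'I_n -> cell S}).
Variable t : {ffun opair n -> pair_type}.

Lemma mem_mk_world_diag p d : (diag_atom p d \in mk_world (c, t)) = c d p.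
Proof. exact: (mk_world_decode (c, t) (inl (p, d))). Qed.

Lemma mem_mk_world_const i (a : atom S var) :
  (map_atom (fun=> i) a \in mk_world (c, t)) = cell_val (c i) a.
Proof.
case: a => [[u v]|[r [v v']]].
  exact: (mem_mk_world_diag (inl u)).
exact: (mem_mk_world_diag (inr r)).
Qed.

Lemma mem_mk_world_pair (p : opair n) (a : atom S var) :
  (map_atom (pair_env (val p).1 (val p).2) a \in mk_world (c, t)) =
  pair_val (c (val p).1) (c (val p).2) (t p) a.
Proof.
case: a => [[u []]|[r [[] []]]] /=.
- exact: (mem_mk_world_diag (inl u)).
- exact: (mem_mk_world_diag (inl u)).
- exact: (mem_mk_world_diag (inr r)).
- exact: (mk_world_decode (c, t) (inr (p, (r, true)))).
- rewrite -(mk_world_decode (c, t) (inr (p, (r, false)))) /=.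
  by case: (val p).
- exact: (mem_mk_world_diag (inr r)).
Qed.

Lemma pair_val_mk_world (p : opair n) q :
  qsat (mk_world (c, t)) (subst (pair_env (val p).1 (val p).2) q) =
  qeval (pair_val (c (val p).1) (c (val p).2) (t p)) q.
Proof.
by rewrite qsat_subst; apply: eq_qeval => a; exact: mem_mk_world_pair.
Qed.

(** Compare the values of the two variables. An assignment with equal values sees only one cell; an
    increasing one evaluates [q] on a pair, and a decreasing one evaluates the swapped [q] on the
    same pair. *)
Lemma univ_models_cells q :
  univ_models (mk_world (c, t)) q =
  [forall i, cell_ok q (c i)] &&
  [forall p, pair_ok q (c (val p).1) (c (val p).2) (t p)].
Proof.
have constE i (env : var -> 'I_n) : env =1 (fun=> i) ->
    qsat (mk_world (c, t)) (subst env q) = cell_ok q (c i).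
  move=> e; rewrite qsat_subst; apply: eq_qeval => a.
  by rewrite (eq_map_atom _ e) mem_mk_world_const.
have fwdE (p : opair n) (env : var -> 'I_n) :
    env =1 pair_env (val p).1 (val p).2 ->
    qsat (mk_world (c, t)) (subst env q) =
    qeval (pair_val (c (val p).1) (c (val p).2) (t p)) q.
  move=> e; rewrite qsat_subst; apply: eq_qeval => a.
  by rewrite (eq_map_atom _ e) mem_mk_world_pair.
have bwdE (p : opair n) (env : var -> 'I_n) :
    env =1 pair_env (val p).2 (val p).1 ->
    qsat (mk_world (c, t)) (subst env q) =
    qeval (pair_val (c (val p).1) (c (val p).2) (t p)) (subst other q).
  move=> e; rewrite qsat_subst qeval_subst; apply: eq_qeval => a /=.
  rewrite -mem_mk_world_pair map_atom_comp.
  rewrite (@eq_map_atom _ _ _ env (pair_env (val p).1 (val p).2 \o other)) //.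
  by case; rewrite e.
apply/forallP/andP => [mod|[/forallP okc /forallP okp] env].
  split; apply/forallP.
    by move=> i; rewrite -(constE i [ffun=> i]) // => v; rewrite ffunE.
  move=> p; apply/andP; split.
    rewrite -(fwdE p [ffun v => pair_env (val p).1 (val p).2 v]) //.
    by move=> v; rewrite ffunE.
  rewrite -(bwdE p [ffun v => pair_env (val p).2 (val p).1 v]) //.
  by move=> v; rewrite ffunE.
have [lt_xy|lt_yx|eq_xy] := ltngtP (env vx) (env vy).
- pose p : opair n := Sub (env vx, env vy) lt_xy.
  by rewrite (fwdE p); [case/andP: (okp p)|case].
- pose p : opair n := Sub (env vy, env vx) lt_yx.
  by rewrite (bwdE p); [case/andP: (okp p)|case].
- by rewrite (constE (env vx)) // => -[] //; apply/val_inj.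
Qed.

End Truth.

(** * The labels of the cell graph and the count they determine *)

Section Weights.
Variables (R : realType) (q : qform S var) (w wbar : pred_sym S -> R).

Definition cell_weight (c : cell S) : R :=
  \prod_p (if c p then w p else wbar p).

Definition type_weight (t : pair_type) : R :=
  \prod_rb (if t rb then w (inr rb.1) else wbar (inr rb.1)).

Lemma diag_weightE n d c :
  diag_weight (fun a : atom S 'I_n => w (pred_of a))
    (fun a => wbar (pred_of a)) d c = cell_weight c.
Proof. by apply: eq_bigr => [[u|r] _]. Qed.

Lemma pair_weightE n p t :
  pair_weight (fun a : atom S 'I_n => w (pred_of a))
    (fun a => wbar (pred_of a)) p t = type_weight t.
Proof. by apply: eq_bigr => [[r b] _]. Qed.

(** A one-element domain has no pairs, so a world is just a cell, and the cell formula leaves only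
    [c]. *)
Lemma vertex_weightE c :
  vertex_weight q w wbar c = (cell_ok q c)%:R * cell_weight c.
Proof.
rewrite /vertex_weight /WMC.
under eq_bigr => omega _ do rewrite prod_in_world.
rewrite (@sum_worlds_cells 1 _ _ _ _
  (fun c' => cell_ok q c && (c' == [ffun=> c])) (fun _ _ => predT)).
  have no_pair (p : opair 1) : False.
    by case: p => [[i j]] /=; rewrite !ord1.
  rewrite big_mkcondl /= big_pred1_eq.
  rewrite big_ord1 ffunE diag_weightE big_pred0 ?mulr1.
    by case: (cell_ok q c); rewrite ?mul1r ?mul0r.
  by move=> p; case: (no_pair p).
move=> c' t; rewrite [in RHS](_ : [forall p, _] = true) ?andbT; last first.
  exact/forallP.
rewrite qsat_subst /= qeval_subst qeval_cell_formula.
have -> : [forall p, map_atom (fun=> ord0) (diag_atom p vx)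
             \in mk_world (c', t) == c p] = (c' == [ffun=> c]).
  apply/forallP/eqP => [e|-> p].
    apply/ffunP => d; apply/ffunP => p; rewrite ffunE -(eqP (e p)) ord1.
    by rewrite -(mem_mk_world_diag c' t); case: p {e}.
  by have := mem_mk_world_diag [ffun=> c] t p ord0; rewrite ffunE; case: p => ? /= ->.
case: eqP => [->|]; rewrite ?andbF // !andbT.
apply: eq_qeval => a /=; rewrite map_atom_comp mem_mk_world_const ffunE //.
Qed.

(** A two-element domain has the single pair [p0]. The cell formulas fix both cells, whose atoms
    have weight 1 in either sign, so only the type of [p0] is summed. *)
Lemma edge_weightE ci cj :
  edge_weight q w wbar ci cj = \sum_(t | pair_ok q ci cj t) type_weight t.
Proof.
rewrite /edge_weight /WMC.
under eq_bigr => omega _ do rewrite prod_in_world.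
pose p0 : opair 2 := Sub (ord0, ord_max) isT.
have pE p : p = p0.
  by apply/val_inj; case: p => [[[[|[]]//= ?] [[|[]]//= ?]] //= _];
    congr (_, _); apply/val_inj.
pose c0 : {ffun 'I_2 -> cell S} := [ffun d => if d == ord0 then ci else cj].
rewrite (@sum_worlds_cells 2 _ _ _ _ (pred1 c0)
  (fun c' _ => pair_ok q ci cj)).
  rewrite big_pred1_eq (big_pred1 p0); last by move=> p; apply/esym/eqP.
  rewrite big1 ?mul1r.
    apply: eq_bigr => t _; apply: eq_bigr => [[r []] _] //=.
  by move=> d _; apply: big1 => [[u|r] _] /=; rewrite ?eqxx; case: ifP.
move=> c' t.
have -> : [forall p, pair_ok q ci cj (t p)] = pair_ok q ci cj (t p0).
  by apply/forallP/idP => // ok p; rewrite (pE p).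
have -> : qsat (mk_world (c', t)) (subst
   (fun v : var => if v == vx then ord0 else ord_max) (psi2 q ci cj)) =
   qeval (pair_val (c' ord0) (c' ord_max) (t p0)) (psi2 q ci cj).
  rewrite -(pair_val_mk_world c' t p0) !qsat_subst; apply: eq_qeval => a.
  by rewrite (@eq_map_atom _ _ _ _ (pair_env ord0 ord_max)) //; case.
rewrite /psi2 /= !qeval_cell_formula andbA andbC.
have -> : [forall p, pair_val (c' ord0) (c' ord_max) (t p0) (diag_atom p vx)
    == ci p] = (c' ord0 == ci).
  by apply/forallP/eqP => [e|<- [u|r]] //=; apply/ffunP => p;
    rewrite -(eqP (e p)); case: p {e}.
have -> : [forall p, pair_val (c' ord0) (c' ord_max) (t p0) (diag_atom p vy)
    == cj p] = (c' ord_max == cj).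
  by apply/forallP/eqP => [e|<- [u|r]] //=; apply/ffunP => p;
    rewrite -(eqP (e p)); case: p {e}.
have -> : (c' == c0) = (c' ord0 == ci) && (c' ord_max == cj).
  apply/eqP/andP => [->|[/eqP e0 /eqP e1]]; first by rewrite !ffunE.
  apply/ffunP => d; rewrite ffunE; case: eqP => [->//|nd].
  rewrite -e1; congr (c' _); apply/val_inj.
  by case: d nd => [[|[]]//= ?] nd; case: nd; apply/val_inj.
by case: eqP => //= ->; case: eqP => //= ->.
Qed.

Lemma univ_count_cell_graph n :
  univ_count q n w wbar =
  \sum_(c : {ffun 'I_n -> cell S})
     (\prod_i vertex_weight q w wbar (c i)) *
     \prod_(p : opair n) edge_weight q w wbar (c (val p).1) (c (val p).2).
Proof.
rewrite /univ_count.
rewrite (@sum_worlds_cells n _ _ _ _ (fun c => [forall i, cell_ok q (c i)])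
  (fun c p => pair_ok q (c (val p).1) (c (val p).2)));
  last by move=> c t; exact: univ_models_cells.
(* Maps that use a forbidden cell stay in the sum as zero terms, matching the indicator inside the
   vertex labels. *)
rewrite big_mkcond; apply: eq_bigr => c _.
under [in RHS]eq_bigr => i _ do rewrite vertex_weightE.
rewrite big_split /= prod_boolr.
under [X in _ = _ * X]eq_bigr => p _ do rewrite edge_weightE.
case: ifP => _; last by rewrite !mul0r.
rewrite mul1r; congr (_ * _).
  by apply: eq_bigr => i _; rewrite diag_weightE.
by apply: eq_bigr => p _; apply: eq_bigr => t _; rewrite pair_weightE.
Qed.

End Weights.
End Cells.

(** * Correctness of Skolemization *)

Lemma eq_sat (S : signature) (D : finType) (omega : world S D) f env env' :
  env =1 env' -> sat omega env f = sat omega env' f.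
Proof.
elim: f env env' => //= [a|g IHg|g IHg h IHh|g IHg h IHh|g IHg h IHh
  |g IHg h IHh|v g IHg|v g IHg] env env' e.
- by rewrite (eq_map_atom _ e).
- by rewrite (IHg _ _ e).
- by rewrite (IHg _ _ e) (IHh _ _ e).
- by rewrite (IHg _ _ e) (IHh _ _ e).
- by rewrite (IHg _ _ e) (IHh _ _ e).
- by rewrite (IHg _ _ e) (IHh _ _ e).
- by apply: eq_forallb => d; apply: IHg => u; rewrite /upd e.
- by apply: eq_existsb => d; apply: IHg => u; rewrite /upd e.
Qed.

(** With only two variables, an assignment updated at [v] remembers nothing but the old value of the
    other variable. *)
Lemma eq_upd_other (D : Type) (env : var -> D) v d :
  upd env v d =1 upd (fun=> env (other v)) v d.
Proof. by case: v; case. Qed.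

(** Two values determine an assignment. Extensionality of [P] is required because [upd] agrees with
    a finite function only pointwise. *)
Lemma forall_env (D : finType) (v : var) (P : (var -> D) -> bool) :
  (forall env env', env =1 env' -> P env = P env') ->
  [forall env : {ffun var -> D}, P env] =
  [forall e, forall d, P (upd (fun=> e) v d)].
Proof.
move=> extP; apply/forallP/forallP => [Penv e|Ped env].
  apply/forallP => d; rewrite -(extP [ffun u => upd (fun=> e) v d u]) //.
  by move=> u; rewrite ffunE.
have /forallP/(_ (env v)) := Ped (env (other v)); rewrite -(extP env) //.
by case: v {Ped}; case.
Qed.

Lemma forall_option (T : finType) (P : pred (option T)) :
  [forall o, P o] = P None && [forall o, P (Some o)].
Proof.
apply/forallP/andP => [Po|[P0 /forallP Ps] [o|] //].
by split; [|apply/forallP].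
Qed.

Lemma forall_sum (T T' : finType) (P : pred (T + T')) :
  [forall o, P o] = [forall o, P (inl o)] && [forall o, P (inr o)].
Proof.
apply/forallP/andP => [Po|[/forallP Pl /forallP Pr] [o|o] //].
by split; apply/forallP.
Qed.

(** * Interpretations of the definition predicates, and the guards of the Skolem predicates *)

Section Skolem.
Variables (S : signature) (D : finType) (omega : world S D).

(** The semantic counterpart of [flatten]: [z] interprets the definition predicates, so that no
    extended signature is involved. *)
Fixpoint flat_sat (f : fo2 S) : (qocc f -> D -> bool) -> (var -> D) -> bool :=
  match f return (qocc f -> D -> bool) -> (var -> D) -> bool with
  | FTop => fun _ _ => true
  | FBot => fun _ _ => false
  | FAtom a => fun _ env => map_atom env a \in omega
  | FNot g => fun z env => ~~ @flat_sat g z env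
  | FAnd g h => fun z env =>
      @flat_sat g (z \o inl) env && @flat_sat h (z \o inr) env
  | FOr g h => fun z env =>
      @flat_sat g (z \o inl) env || @flat_sat h (z \o inr) env
  | FImp g h => fun z env =>
      @flat_sat g (z \o inl) env ==> @flat_sat h (z \o inr) env
  | FIff g h => fun z env =>
      @flat_sat g (z \o inl) env == @flat_sat h (z \o inr) env
  | FAll v _ | FEx v _ => fun z env => z None (env (other v))
  end.

(* the conjuncts of [definitions] without Skolem predicate *)
Fixpoint hard (f : fo2 S) : (qocc f -> D -> bool) -> bool :=
  match f return (qocc f -> D -> bool) -> bool with
  | FTop | FBot | FAtom _ => fun _ => true
  | FNot g => fun z => @hard g z
  | FAnd g h | FOr g h | FImp g h | FIff g h => fun z =>
      @hard g (z \o inl) && @hard h (z \o inr)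
  | FAll v g => fun z =>
      [forall e, forall d,
         z None e ==> @flat_sat g (z \o Some) (upd (fun=> e) v d)] &&
      @hard g (z \o Some)
  | FEx v g => fun z =>
      [forall e, forall d,
         @flat_sat g (z \o Some) (upd (fun=> e) v d) ==> z None e] &&
      @hard g (z \o Some)
  end.

(* the existential statement guarded by each Skolem predicate *)
Fixpoint need (f : fo2 S) : (qocc f -> D -> bool) -> qocc f -> D -> bool :=
  match f return (qocc f -> D -> bool) -> qocc f -> D -> bool with
  | FTop | FBot | FAtom _ => fun _ _ _ => true
  | FNot g => fun z => @need g z
  | FAnd g h | FOr g h | FImp g h | FIff g h => fun z o =>
      match o with
      | inl o' => @need g (z \o inl) o'
      | inr o' => @need h (z \o inr) o'
      end
  | FAll v g => fun z o =>
      match o with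
      | Some o' => @need g (z \o Some) o'
      | None => fun e => [exists d,
          @flat_sat g (z \o Some) (upd (fun=> e) v d) ==> z None e]
      end
  | FEx v g => fun z o =>
      match o with
      | Some o' => @need g (z \o Some) o'
      | None => fun e => [exists d,
          z None e ==> @flat_sat g (z \o Some) (upd (fun=> e) v d)]
      end
  end.

(** The intended interpretation of the definition predicates; the value [e] is that of the variable
    left free by the quantifier. *)
Fixpoint quant_truth (f : fo2 S) : qocc f -> D -> bool :=
  match f return qocc f -> D -> bool with
  | FTop | FBot | FAtom _ => fun _ _ => true
  | FNot g => @quant_truth g
  | FAnd g h | FOr g h | FImp g h | FIff g h => fun o =>
      match o with
      | inl o' => @quant_truth g o'
      | inr o' => @quant_truth h o'
      end
  | FAll v g => fun o =>
      match o with
      | Some o' => @quant_truth g o'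
      | None => fun e => [forall d, sat omega (upd (fun=> e) v d) g]
      end
  | FEx v g => fun o =>
      match o with
      | Some o' => @quant_truth g o'
      | None => fun e => [exists d, sat omega (upd (fun=> e) v d) g]
      end
  end.

Lemma eq_flat_sat f z env env' :
  env =1 env' -> @flat_sat f z env = @flat_sat f z env'.
Proof.
move=> e; elim: f z => //= [a|g IHg|g IHg h IHh|g IHg h IHh|g IHg h IHh
  |g IHg h IHh|v g IHg|v g IHg] z; rewrite ?IHg ?IHh ?e //.
by rewrite (eq_map_atom _ e).
Qed.

Lemma flat_sat_truth f z env :
  z =2 @quant_truth f -> @flat_sat f z env = sat omega env f.
Proof.
elim: f z => //= [g IHg|g IHg h IHh|g IHg h IHh|g IHg h IHh
  |g IHg h IHh|v g IHg|v g IHg] z ez.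
- by rewrite (IHg _ ez).
- by rewrite (IHg _ (fun o => ez (inl o))) (IHh _ (fun o => ez (inr o))).
- by rewrite (IHg _ (fun o => ez (inl o))) (IHh _ (fun o => ez (inr o))).
- by rewrite (IHg _ (fun o => ez (inl o))) (IHh _ (fun o => ez (inr o))).
- by rewrite (IHg _ (fun o => ez (inl o))) (IHh _ (fun o => ez (inr o))).
- by rewrite ez; apply: eq_forallb => d; exact/esym/eq_sat/eq_upd_other.
- by rewrite ez; apply: eq_existsb => d; exact/esym/eq_sat/eq_upd_other.
Qed.

Definition forall2 (I : finType) (z : I -> D -> bool) : bool :=
  [forall o, forall e, z o e].

Definition eqz (I : finType) (z z' : I -> D -> bool) : bool :=
  forall2 (fun o e => z o e == z' o e).

Lemma eqzP (I : finType) (z z' : I -> D -> bool) :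
  reflect (z =2 z') (eqz z z').
Proof.
apply: (iffP forallP) => [e o d|e o]; first exact/eqP/(forallP (e o)).
by apply/forallP => d; rewrite e.
Qed.

Lemma forall2_sum (I J : finType) (z : I + J -> D -> bool) :
  forall2 z = forall2 (z \o inl) && forall2 (z \o inr).
Proof. exact: forall_sum. Qed.

Lemma forall2_option (I : finType) (z : option I -> D -> bool) :
  forall2 z = [forall e, z None e] && forall2 (z \o Some).
Proof. exact: forall_option. Qed.

Lemma forall_andb (T : finType) (P Q : pred T) :
  [forall x, P x && Q x] = [forall x, P x] && [forall x, Q x].
Proof.
apply/forallP/andP => [PQ|[/forallP Px /forallP Qx] x]; last by rewrite Px Qx.
by split; apply/forallP => x; case/andP: (PQ x).
Qed.

(** The two halves [hard] and [need] of a definition together make its predicate equivalent to the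
    quantified subformula. By induction the predicates inside the body are already correct, so the
    flattened body has the truth value of the body. *)
Lemma hard_need_truth f z :
  @hard f z && forall2 (@need f z) = eqz z (@quant_truth f).
Proof.
elim: f z => [||a|g IHg|g IHg h IHh|g IHg h IHh|g IHg h IHh|g IHg h IHh
  |v g IHg|v g IHg] z; rewrite /eqz /=; try by apply/forallP/forallP => _ [].
- by rewrite IHg.
- by rewrite !forall2_sum andbACA /= IHg IHh.
- by rewrite !forall2_sum andbACA /= IHg IHh.
- by rewrite !forall2_sum andbACA /= IHg IHh.
- by rewrite !forall2_sum andbACA /= IHg IHh.
- rewrite !forall2_option andbACA /= IHg.
  (* Correctness of the inner predicates is a conjunct of both sides, so it may be assumed when
     comparing the rest. *)
  apply: andb_id2r => /eqzP/flat_sat_truth ez; rewrite -forall_andb.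
  apply: eq_forallb => e.
  under eq_forallb => d do rewrite ez.
  under eq_existsb => d do rewrite ez.
  case: (z None e) => /=.
    rewrite [X in _ && X](_ : _ = true) ?andbT //.
    (* The implication is trivial but the existential still needs an element; [e] supplies one. *)
    by apply/existsP; exists e; rewrite implybT.
  rewrite [X in X && _](_ : _ = true) /=; last exact/forallP.
  rewrite eq_sym eqbF_neg negb_forall.
  by apply: eq_existsb => d; rewrite ?implybF.
- rewrite !forall2_option andbACA /= IHg.
  apply: andb_id2r => /eqzP/flat_sat_truth ez; rewrite -forall_andb.
  apply: eq_forallb => e.
  under eq_forallb => d do rewrite ez.
  under eq_existsb => d do rewrite ez.
  case: (z None e) => /=.
    rewrite [X in X && _](_ : _ = true) //.
    by apply/forallP => d; rewrite implybT.
  rewrite [X in _ && X](_ : _ = true) ?andbT; last by apply/existsP; exists e.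
  rewrite eq_sym eqbF_neg negb_exists.
  by apply: eq_forallb => d; rewrite ?implybF.
Qed.

(** * Reading the Skolemized matrix in a world over the extended signature *)

Section Encoding.
Variables (U : finType) (old : unary S -> U).
Variable omega' : world (Signature U (binary S)) D.

Definition encodes_base : Prop :=
  (forall u e, ((inl (old u, e) : atom (Signature U (binary S)) D) \in omega')
     = ((inl (u, e) : atom S D) \in omega)) /\
  (forall x, ((inr x : atom (Signature U (binary S)) D) \in omega')
     = ((inr x : atom S D) \in omega)).

Definition encodes (I : finType) (d : I -> U) (z : I -> D -> bool) : Prop :=
  forall o e, ((inl (d o, e) : atom (Signature U (binary S)) D) \in omega')
     = z o e.

Hypothesis base : encodes_base.

Lemma flattenE f d z env : encodes d z ->
  qsat omega' (subst env (@Defs.flatten S U old f d)) = @flat_sat f z env.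
Proof.
elim: f d z => //= [a|g IHg|g IHg h IHh|g IHg h IHh|g IHg h IHh
  |g IHg h IHh] d z dz.
- by case: a => [[u v]|[r [v v']]] /=; case: base => b1 b2; rewrite ?b1 ?b2.
- by rewrite (IHg _ z).
- by rewrite (IHg _ (z \o inl)) ?(IHh _ (z \o inr)) // => o e; exact: dz.
- by rewrite (IHg _ (z \o inl)) ?(IHh _ (z \o inr)) // => o e; exact: dz.
- by rewrite (IHg _ (z \o inl)) ?(IHh _ (z \o inr)) // => o e; exact: dz.
- by rewrite (IHg _ (z \o inl)) ?(IHh _ (z \o inr)) // => o e; exact: dz.
Qed.

Lemma univ_models_and (S0 : signature) (om : world S0 D) q q' :
  univ_models om (QAnd q q') = univ_models om q && univ_models om q'.
Proof. exact: forall_andb. Qed.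

Lemma univ_models_top (S0 : signature) (om : world S0 D) :
  univ_models om QTop.
Proof. exact/forallP. Qed.

Lemma univ_modelsE (S0 : signature) (om : world S0 D) v q :
  univ_models om q =
  [forall e, forall d, qsat om (subst (upd (fun=> e) v d) q)].
Proof.
apply: (forall_env v (P := fun env => qsat om (subst env q))) => env env' e.
by rewrite !qsat_subst; apply: eq_qeval => a; rewrite (eq_map_atom _ e).
Qed.

Lemma upd_other (e : D) v d : upd (fun=> e) v d (other v) = e.
Proof. by case: v. Qed.

(** The Skolem atom does not depend on [d], so the universal [d] becomes an existential in the
    premise. *)
Lemma forall_or_guard (k : D -> bool) (P : D -> D -> bool) :
  [forall e, forall d, k e || ~~ P e d] = [forall e, [exists d, P e d] ==> k e].
Proof.
apply: eq_forallb => e; apply/forallP/implyP => [kP /existsP[d Pd]|kP d].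
  by have := kP d; rewrite Pd orbF.
by case: (boolP (P e d)) => Pd; rewrite ?orbT // kP //; apply/existsP; exists d.
Qed.

(** Universal closure distributes over conjunction, so each clause is read on its own: those without
    Skolem atom give [hard], the others say that a guard forces its Skolem atom. The interpretations
    [z] and [k] are arbitrary here. *)
Lemma definitionsE f d s z k : encodes d z -> encodes s k ->
  univ_models omega' (@definitions S U old f d s) =
  @hard f z && forall2 (fun o e => @need f z o e ==> k o e).
Proof.
elim: f d s z k => [||a|g IHg|g IHg h IHh|g IHg h IHh|g IHg h IHh|g IHg h IHh
  |v g IHg|v g IHg] d s z k dz sk /=;
  try by rewrite univ_models_top; apply/esym/forallP => -[].
- exact: IHg.
- by rewrite univ_models_and forall2_sum andbACA (IHg _ _ (z \o inl) (k \o inl))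
    ?(IHh _ _ (z \o inr) (k \o inr)) // => o e; rewrite ?dz ?sk.
- by rewrite univ_models_and forall2_sum andbACA (IHg _ _ (z \o inl) (k \o inl))
    ?(IHh _ _ (z \o inr) (k \o inr)) // => o e; rewrite ?dz ?sk.
- by rewrite univ_models_and forall2_sum andbACA (IHg _ _ (z \o inl) (k \o inl))
    ?(IHh _ _ (z \o inr) (k \o inr)) // => o e; rewrite ?dz ?sk.
- by rewrite univ_models_and forall2_sum andbACA (IHg _ _ (z \o inl) (k \o inl))
    ?(IHh _ _ (z \o inr) (k \o inr)) // => o e; rewrite ?dz ?sk.
- have dz' : encodes (d \o Some) (z \o Some) by move=> o e; exact: dz.
  have sk' : encodes (s \o Some) (k \o Some) by move=> o e; exact: sk.
  rewrite !univ_models_and (IHg _ _ _ _ dz' sk') forall2_option /= andbACA andbA.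
  congr (_ && _).
  rewrite !(univ_modelsE _ v) /= -forall_or_guard; congr (_ && _).
    apply: eq_forallb => e; apply: eq_forallb => x.
    by rewrite (flattenE _ dz') upd_other dz.
  apply: eq_forallb => e; apply: eq_forallb => x.
  by rewrite (flattenE _ dz') upd_other dz sk.
- have dz' : encodes (d \o Some) (z \o Some) by move=> o e; exact: dz.
  have sk' : encodes (s \o Some) (k \o Some) by move=> o e; exact: sk.
  rewrite !univ_models_and (IHg _ _ _ _ dz' sk') forall2_option /= andbACA andbA.
  congr (_ && _).
  rewrite !(univ_modelsE _ v) /= -forall_or_guard; congr (_ && _).
    apply: eq_forallb => e; apply: eq_forallb => x.
    by rewrite (flattenE _ dz') upd_other dz.
  apply: eq_forallb => e; apply: eq_forallb => x.
  by rewrite (flattenE _ dz') upd_other dz sk.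
Qed.

End Encoding.

(* [q] splits into a part free of Skolem predicates and guards, which
   together pin down the definition predicates and assert [b]. *)
Definition skolemizes (I J : finType)
    (q : forall U : finType, (unary S -> U) -> (I -> U) -> (J -> U) ->
         qform (Signature U (binary S)) var) (b : bool) : Prop :=
  exists (h : (I -> D -> bool) -> bool) (m : (I -> D -> bool) -> J -> D -> bool)
    (z0 : I -> D -> bool),
    (forall (U : finType) (old : unary S -> U)
        (omega' : world (Signature U (binary S)) D) d s z k,
      encodes_base old omega' -> encodes omega' d z -> encodes omega' s k ->
      univ_models omega' (q U old d s) =
      h z && forall2 (fun o e => m z o e ==> k o e)) /\
    (forall z, h z && forall2 (m z) = eqz z z0 && b).

(** The flattened formula joins the part free of Skolem predicates; once the definition predicates
    are forced to be correct, it means [f] itself. *)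
Lemma skolemizes_default f :
  @skolemizes (qocc f) (qocc f)
    (fun U old d s =>
       QAnd (@Defs.flatten S U old f d) (@definitions S U old f d s))
    (models omega f).
Proof.
exists (fun z => [forall env : {ffun var -> D}, flat_sat z env] && @hard f z).
exists (@need f), (@quant_truth f); split.
  move=> U old omega' d s z k base dz sk; rewrite univ_models_and.
  rewrite (definitionsE base dz sk) andbA; congr (_ && _ && _).
  by apply: eq_forallb => env; rewrite (flattenE base _ dz).
move=> z; rewrite -andbA hard_need_truth andbC.
apply: andb_id2l => /eqzP ez; apply: eq_forallb => env.
exact: flat_sat_truth.
Qed.

Lemma matrix_skolemizes f :
  @skolemizes (docc f) (socc f) (fun U old => @Defs.matrix S U old f)
    (models omega f).
Proof.
elim: f => [||a|g _|g IHg h IHh|g _ h _|g _ h _|g _ h _|v g IHg|v g _];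
  try exact: skolemizes_default.
- case: IHg => hg [mg [zg [IHg1 IHg2]]]; case: IHh => hh [mh [zh [IHh1 IHh2]]].
  exists (fun z => hg (z \o inl) && hh (z \o inr)).
  exists (fun z o => match o with inl o' => mg (z \o inl) o'
                                | inr o' => mh (z \o inr) o' end).
  exists (fun o => match o with inl o' => zg o' | inr o' => zh o' end); split.
    move=> U old omega' d s z k base dz sk /=; rewrite univ_models_and.
    rewrite (IHg1 _ _ _ _ _ (z \o inl) (k \o inl) base) //;
      try by move=> o e; rewrite ?dz ?sk.
    rewrite (IHh1 _ _ _ _ _ (z \o inr) (k \o inr) base) //;
      try by move=> o e; rewrite ?dz ?sk.
    by rewrite forall2_sum andbACA.
  move=> z; rewrite forall2_sum andbACA /= IHg2 IHh2 andbACA /eqz forall2_sum.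
  by congr (_ && _); rewrite /models /= forall_andb.
(* The data of the body are reused, since [g] and [FAll v g] have the same universal closure. *)
- case: IHg => h [m [z0 [IHg1 IHg2]]]; exists h, m, z0; split => // z.
  rewrite IHg2; congr (_ && _).
  rewrite /models (@forall_env _ v (fun env => sat omega env g)); last first.
    by move=> env env'; exact: eq_sat.
  rewrite (@forall_env _ v (fun env => sat omega env (FAll v g))); last first.
    by move=> env env'; exact: eq_sat.
  apply: eq_forallb => e /=; apply/forallP/forallP => ok d.
    apply/forallP => d'; rewrite (eq_sat _ _ (eq_upd_other _ _ _)) upd_other.
    exact: ok.
  have /forallP/(_ d) := ok d.
  by rewrite (eq_sat _ _ (eq_upd_other _ _ _)) upd_other.
(* The outer existential gets no definition predicate: it is itself the guard of the Skolem
   predicate [None], while the body is flattened and defined as usual. *)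
- exists (@hard g).
  exists (fun z o => match o with
    | Some o' => need z o'
    | None => fun e => [exists d, flat_sat z (upd (fun=> e) v d)] end).
  exists (@quant_truth g); split.
    move=> U old omega' d s z k base dz sk /=; rewrite univ_models_and.
    have sk' : encodes omega' (s \o Some) (k \o Some) by move=> o e; exact: sk.
    rewrite (definitionsE base dz sk') forall2_option /= andbCA.
    congr (_ && (_ && _)); rewrite (univ_modelsE _ v) -forall_or_guard.
    apply: eq_forallb => e; apply: eq_forallb => x /=.
    by rewrite (flattenE base _ dz) upd_other sk.
  move=> z; rewrite forall2_option /= andbCA hard_need_truth andbC.
  apply: andb_id2l => /eqzP ez.
  rewrite /models (@forall_env _ v (fun env => sat omega env (FEx v g))).
    apply: eq_forallb => e /=; apply/existsP/forallP => [[d ok] d'|ok].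
      apply/existsP; exists d; rewrite (eq_sat _ _ (eq_upd_other _ _ _)).
      by rewrite upd_other -(flat_sat_truth _ ez).
    have /existsP[d ok'] := ok e; exists d; move: ok'.
    by rewrite (eq_sat _ _ (eq_upd_other _ _ _)) upd_other -(flat_sat_truth _ ez).
  by move=> env env'; exact: eq_sat.
Qed.

End Skolem.

(** * Summing out the definition and Skolem predicates *)

Section SkolemCount.
Variables (R : realType) (S : signature) (f : fo2 S) (D : finType).

Definition skolem_world
    (x : world S D * ({ffun docc f * D -> bool} * {ffun socc f * D -> bool})) :
    world (skolem_sig f) D :=
  [set a | match a with
           | inl (inl u, e) => (inl (u, e) : atom S D) \in x.1
           | inl (inr (inl o), e) => x.2.1 (o, e)
           | inl (inr (inr o), e) => x.2.2 (o, e)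
           | inr y => (inr y : atom S D) \in x.1
           end].

Lemma skolem_world_bij : bijective skolem_world.
Proof.
exists (fun om : world (skolem_sig f) D =>
  ([set a : atom S D | match a with
     | inl (u, e) => (inl (inl u, e) : atom (skolem_sig f) D) \in om
     | inr y => (inr y : atom (skolem_sig f) D) \in om
     end],
   ([ffun oe : docc f * D =>
       (inl (inr (inl oe.1), oe.2) : atom (skolem_sig f) D) \in om],
    [ffun oe : socc f * D =>
       (inl (inr (inr oe.1), oe.2) : atom (skolem_sig f) D) \in om]))).
  move=> [om [z k]]; congr (_, (_, _)).
  - by apply/setP => -[[u e]|y]; rewrite !inE.
  - by apply/ffunP => -[o e]; rewrite ffunE inE.
  - by apply/ffunP => -[o e]; rewrite ffunE inE.
move=> om; apply/setP => -[[[u|[o|o]] e]|y]; rewrite !inE ?ffunE //.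
Qed.

Lemma prod_atoms (T : signature) (F : atom T D -> R) :
  \prod_a F a = (\prod_u F (inl u)) * \prod_r F (inr r).
Proof. exact: big_sumType. Qed.

Lemma skolem_world_weight (w wbar : pred_sym S -> R) om z k :
  \prod_l (if l \in skolem_world (om, (z, k))
           then skolem_weight 1 w (pred_of l)
           else skolem_weight (-1) wbar (pred_of l)) =
  (\prod_l (if l \in om then w (pred_of l) else wbar (pred_of l))) *
  \prod_oe (if k oe then 1 else -1).
Proof.
rewrite !prod_atoms mulrAC; congr (_ * _); last first.
  by apply: eq_bigr => [[r [e e']] _]; rewrite inE.
have prod_pair (I : finType) (F : I * D -> R) :
    \prod_x F x = \prod_i \prod_e F (i, e).
  by rewrite pair_bigA; apply: eq_bigr => -[].
rewrite !prod_pair !big_sumType /=; congr (_ * _).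
  by apply: eq_bigr => u _; apply: eq_bigr => e _; rewrite inE.
(* The definition predicates have weight 1 in both signs, so only the Skolem atoms leave a
   factor. *)
rewrite big1 ?mul1r.
  by apply: eq_bigr => o _; apply: eq_bigr => e _; rewrite inE.
by move=> o _; apply: big1 => e _; case: ifP.
Qed.

(* A Skolem atom whose guard holds must be true and contributes 1; one whose
   guard fails is free and contributes 1 - 1 = 0. *)
Lemma sum_skolem_atoms (I : finType) (m : pred I) :
  \sum_(k : {ffun I -> bool} | [forall i, m i ==> k i])
     \prod_i (if k i then 1 else -1) = [forall i, m i]%:R :> R.
Proof.
rewrite -prod_boolr.
transitivity (\prod_i \sum_(b : bool | m i ==> b) (if b then 1 else -1 : R)).
  by rewrite bigA_distr_big_dep.
apply: eq_bigr => i _; rewrite big_mkcond big_bool /=.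
by case: (m i); rewrite ?addr0 ?subrr.
Qed.

End SkolemCount.

Lemma WFOMC_skolem (R : realType) (S : signature) (f : fo2 S) n
    (w wbar : pred_sym S -> R) :
  WFOMC f n w wbar =
  univ_count (skolem_matrix f) n (skolem_weight 1 w) (skolem_weight (-1) wbar).
Proof.
rewrite /univ_count (reindex (@skolem_world S f 'I_n)); last first.
  exact/onW_bij/skolem_world_bij.
transitivity (\sum_(om : world S 'I_n)
    \sum_(zk : {ffun docc f * 'I_n -> bool} * {ffun socc f * 'I_n -> bool}
          | univ_models (skolem_world (om, zk)) (skolem_matrix f))
      (\prod_l (if l \in om then w (pred_of l) else wbar (pred_of l))) *
      \prod_oe (if zk.2 oe then 1 else -1)); last first.
  rewrite pair_big_dep; apply: eq_big => [[om zk]|[om [z k]] _] //.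
  by rewrite skolem_world_weight.
rewrite /WFOMC big_mkcond; apply: eq_bigr => om _; rewrite prod_in_world.
rewrite -big_distrr /=.
have [h [m [z0 [matE pinE]]]] := matrix_skolemizes om f.
pose cur (I : finType) (z : {ffun I * 'I_n -> bool}) o e := z (o, e).
have {}matE z k : univ_models (skolem_world (om, (z, k))) (skolem_matrix f) =
    h (cur _ z) && [forall oe, m (cur _ z) oe.1 oe.2 ==> k oe].
  rewrite (matE _ _ _ _ _ (cur _ z) (cur _ k)).
  - congr (_ && _); apply/forallP/forallP => [mk [o e]|mk o].
      exact: (forallP (mk o) e).
    by apply/forallP => e; exact: (mk (o, e)).
  - by split => [u e|y]; rewrite inE.
  - by move=> o e; rewrite inE.
  - by move=> o e; rewrite inE.
transitivity (\prod_l (if l \in om then w (pred_of l) else wbar (pred_of l)) *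
    \sum_(z : {ffun docc f * 'I_n -> bool} | h (cur _ z))
    \sum_(k : {ffun socc f * 'I_n -> bool}
         | [forall oe, m (cur _ z) oe.1 oe.2 ==> k oe])
      \prod_oe (if k oe then 1 else -1)); last first.
  by rewrite pair_big_dep; congr (_ * _); apply: eq_bigl => -[z k]; rewrite matE.
under [X in _ = _ * X]eq_bigr => z _ do rewrite sum_skolem_atoms.
(* The only interpretation of the definition predicates that can contribute; its term is 1 or 0
   according to whether [om] models [f]. *)
pose zt : {ffun docc f * 'I_n -> bool} := [ffun oe => z0 oe.1 oe.2].
transitivity (\prod_l (if l \in om then w (pred_of l) else wbar (pred_of l)) *
    \sum_z (if z == zt then (models om f)%:R else 0)).
  rewrite -big_mkcond big_pred1_eq.
  by case: (models om f); rewrite ?mulr1 ?mulr0.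
rewrite [X in _ = _ * X]big_mkcond; congr (_ * _); apply: eq_bigr.
move=> z _.
have -> : [forall oe, m (cur _ z) oe.1 oe.2] = forall2 (m (cur _ z)).
  apply/forallP/forallP => [mz o|mz [o e]]; last exact: (forallP (mz o) e).
  by apply/forallP => e; exact: (mz (o, e)).
have -> : (z == zt) = eqz (cur _ z) z0.
  apply/eqP/eqzP => [-> o e|ez]; first by rewrite /cur ffunE.
  by apply/ffunP => -[o e]; rewrite ffunE -ez.
have := pinE (cur _ z).
by case: (h _) (forall2 _) (eqz _ _) (models _ _) => [] [] [] [].
Qed.

(** * Invariance of the count under isomorphism of cell graphs *)

Theorem theorem1 (R : realType) (S S' : signature)
    (phi : fo2 S) (psi : fo2 S')
    (w wbar : pred_sym S -> R) (w' wbar' : pred_sym S' -> R)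
    (phi_sentence : sentence phi) (psi_sentence : sentence psi)
    (iso : isomorphic (cell_graph_of phi w wbar)
                      (cell_graph_of psi w' wbar')) :
  forall n : nat, WFOMC phi n w wbar = WFOMC psi n w' wbar'.
Proof.
move=> n; rewrite !WFOMC_skolem !univ_count_cell_graph.
case: iso => /= F [[G FK GK] vE eE].
(* Composition with the bijection [F] matches the maps into the cells of [phi] with those into the
   cells of [psi], after which the labels agree factor by factor. *)
rewrite (reindex (fun c : {ffun 'I_n -> _} => [ffun i => F (c i)])); last first.
  apply: onW_bij; exists (fun c : {ffun 'I_n -> _} => [ffun i => G (c i)]) => c;
  by apply/ffunP => i; rewrite !ffunE ?FK ?GK.
apply: eq_bigr => c _; congr (_ * _).
  by apply: eq_bigr => i _; rewrite ffunE vE.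
by apply: eq_bigr => p _; rewrite !ffunE eE.
Qed.
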